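(* Let $n\ge1$ be an integer with $n\neq 1$, let $q_n=x_1^2+\cdots+x_n^2$, $T_{n,3}=\binom{n+2}{3}$ and $B_{n,3}=\frac{2(n+4)}{5(n+1)}$. Suppose there are points $\mathbf{a}_1,\dots,\mathbf{a}_{T_{n,3}}\in\mathbb{C}^n$ with $$\frac{1}{B_{n,3}}\,q_n^3=\sum_{j=1}^{T_{n,3}}(\mathbf{a}_j\cdot\mathbf{x})^6$$ (that is, up to the scalar factor, a tight decomposition of $q_n^3$). Then $n\equiv 2 \pmod 3$.
   Context: Here $\mathbf{a}\cdot\mathbf{x}=a_1x_1+\cdots+a_nx_n$ for $\mathbf{a}=(a_1,\dots,a_n)\in\mathbb{C}^n$, and the identity is in $\mathbb{C}[x_1,\dots,x_n]$. A decomposition of (a scalar multiple of) $q_n^3$ as a sum of sixth powers of complex linear forms is called tight if its number of summands is $T_{n,3}$. *)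

(* Defs.v *)
From HB Require Import structures.
From mathcomp Require Import all_boot all_order all_algebra.
From mathcomp Require Import complex mpoly reals.

Set Implicit Arguments.
Unset Strict Implicit.
Unset Printing Implicit Defensive.

Import GRing.Theory Num.Theory.
Local Open Scope ring_scope.

Definition qform {K : fieldType} (n : nat) : {mpoly K[n]} :=
  \sum_(i < n) 'X_i ^+ 2.

(* The product is bilinear: no complex conjugation is involved. *)
Definition linform {K : fieldType} (n : nat) (a : 'rV[K]_n) : {mpoly K[n]} :=
  \sum_(i < n) a ord0 i *: 'X_i.

Definition tight_size3 (n : nat) : nat := 'C(n + 2, 3).

Definition Bcoef3 {K : fieldType} (n : nat) : K :=
  (2 * (n + 4))%:R / (5 * (n + 1))%:R.

(* Main.v *)
Require Import Defs.
From HB Require Import structures.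
From mathcomp Require Import all_boot all_order all_algebra.
From mathcomp Require Import complex mpoly reals.
From mathcomp Require Import ring zify.

(** Write [T = tight_size3 n], [L_a = linform a] and [q = qform n].

    Differentiating the hypothesis by a well chosen cubic operator makes the
    cubes of the [L_(a j)] rigid.  The operator
    [(n + 4) (b.d)^3 - 3 (b.b) Laplacian (b.d)] sends [q ^+ 3] to
    [48 (n + 4) L_b ^+ 3] and [L_a ^+ 6] to [120 f(a, b) L_a ^+ 3], where
    [f(a, b) = (n + 4) (a.b)^3 - 3 (a.a) (b.b) (a.b)].  Hence the hypothesis
    yields, for every [b],
      [(n + 1) L_b ^+ 3 = \sum_j f(a j, b) L_(a j) ^+ 3]
    (lemma [cube_reproducing]).  Cubes of linear forms span all cubic forms by
    polarization, so the [T] cubes [L_(a j) ^+ 3] span a space of dimension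
    [T] and are therefore linearly independent; taking [b = a k] gives
    [f(a j, a k) = (n + 1) delta_jk] (lemma [dual_cubic_tight]).  So
    [(a j).(a j)] is nonzero and, for [j != k],
    [(a j).(a k)] is [0] or a square root of
    [3 / (n + 4) * ((a j).(a j)) * ((a k).(a k))].

    After division of each [a j] by a square root of [(a j).(a j)], the Gram
    matrix is [1 + c A] with [c ^+ 2 = 3 / (n + 4)] and [A] an integer matrix.
    There are [T > n] vectors in dimension [n], so this Gram matrix is
    singular, [- 1 / c] is an eigenvalue of [A], and [(n + 4) / 3] is an
    eigenvalue of the integer matrix [A *m A].  A rational eigenvalue of an
    integer matrix is an integer, so [3] divides [n + 4]
    (lemma [equiangular_dvd]). *)

Set Implicit Arguments.
Unset Strict Implicit.
Unset Printing Implicit Defensive.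

Import GRing.Theory Num.Theory.
Local Open Scope ring_scope.
Local Open Scope complex_scope.

(** * Linear forms and the bilinear dot product *)

Definition dot {K : fieldType} (n : nat) (a b : 'rV[K]_n) : K :=
  \sum_(i < n) a ord0 i * b ord0 i.

Lemma linformD (K : fieldType) (n : nat) (a b : 'rV[K]_n) :
  linform (a + b) = linform a + linform b.
Proof.
by rewrite /linform -big_split; apply: eq_bigr => i _; rewrite mxE scalerDl.
Qed.

Lemma linformN (K : fieldType) (n : nat) (a : 'rV[K]_n) :
  linform (- a) = - linform a.
Proof.
by rewrite /linform -sumrN; apply: eq_bigr => i _; rewrite mxE scaleNr.
Qed.

Lemma linform_delta (K : fieldType) (n : nat) (i : 'I_n) :
  linform (delta_mx ord0 i : 'rV[K]_n) = 'X_i.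
Proof.
rewrite /linform (bigD1 i) //= mxE !eqxx scale1r big1 ?addr0 // => j ne_ji.
by rewrite mxE (negbTE ne_ji) andbF scale0r.
Qed.

(** * Differentiating powers of linear and quadratic forms *)

Section Differentiation.
Variables (K : fieldType) (n : nat).
Implicit Types (a b : 'rV[K]_n) (p q : {mpoly K[n]}).

Definition dirder b p : {mpoly K[n]} := \sum_(i < n) b ord0 i *: p^`M(i).
Definition laplacian p : {mpoly K[n]} := \sum_(i < n) p^`M(i)^`M(i).

Lemma dirder_is_linear b : linear (dirder b).
Proof.
move=> c p q; rewrite /dirder scaler_sumr -big_split; apply: eq_bigr => i _.
by rewrite linearP scalerDr !scalerA mulrC.
Qed.

HB.instance Definition _ b :=
  GRing.isLinear.Build K {mpoly K[n]} {mpoly K[n]} _ (dirder b)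
    (dirder_is_linear b).

Lemma laplacian_is_linear : linear laplacian.
Proof.
move=> c p q; rewrite /laplacian scaler_sumr -big_split; apply: eq_bigr => i _.
by rewrite !linearP.
Qed.

HB.instance Definition _ :=
  GRing.isLinear.Build K {mpoly K[n]} {mpoly K[n]} _ laplacian
    laplacian_is_linear.

Lemma mderivXn i p k : (p ^+ k.+1)^`M(i) = k.+1%:R * p ^+ k * p^`M(i).
Proof.
elim: k => [|k IHk]; first by rewrite !expr1 expr0 !mul1r.
by rewrite exprS mderivM IHk exprS -[k.+2]addn1 natrD; ring.
Qed.

Lemma dirderM b p q : dirder b (p * q) = dirder b p * q + p * dirder b q.
Proof.
rewrite /dirder mulr_suml mulr_sumr -big_split; apply: eq_bigr => i _ /=.
by rewrite mderivM scalerDr scalerAl scalerAr.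
Qed.

Lemma dirderXn b p k : dirder b (p ^+ k.+1) = k.+1%:R * p ^+ k * dirder b p.
Proof.
rewrite /dirder mulr_sumr; apply: eq_bigr => i _.
by rewrite mderivXn scalerAr.
Qed.

Lemma dirderC b (c : K) : dirder b c%:MP = 0.
Proof. by rewrite /dirder big1 // => i _; rewrite mderivC scaler0. Qed.

Lemma mderiv_var (i j : 'I_n) :
  ('X_j : {mpoly K[n]})^`M(i) = (j == i)%:R.
Proof.
rewrite mderivX mnm1E; case: eqP => [->|_]; last by rewrite scale0r.
by rewrite scale1r -[X in (X - _)%MM]add0m addmK mpolyX0.
Qed.

Lemma mderiv_linform a i : (linform a)^`M(i) = (a ord0 i)%:MP.
Proof.
rewrite /linform raddf_sum /= (bigD1 i) //= linearZ /= mderiv_var eqxx.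
rewrite big1 ?addr0 ?alg_mpolyC // => j ne_ji.
by rewrite linearZ /= mderiv_var (negbTE ne_ji) scaler0.
Qed.

Lemma mderiv_qform i : (qform n : {mpoly K[n]})^`M(i) = 2 * 'X_i.
Proof.
rewrite /qform raddf_sum /= (bigD1 i) //= mderivXn mderiv_var eqxx mulr1 expr1.
rewrite big1 ?addr0 // => j ne_ji.
by rewrite mderivXn mderiv_var (negbTE ne_ji) mulr0.
Qed.

Lemma dirder_linform a b : dirder b (linform a) = (dot a b)%:MP.
Proof.
rewrite /dirder raddf_sum /=; apply: eq_bigr => i _.
by rewrite mderiv_linform -mul_mpolyC -mpolyCM mulrC.
Qed.

Lemma dirder_qform b : dirder b (qform n) = 2 * linform b.
Proof.
rewrite /dirder /linform mulr_sumr; apply: eq_bigr => i _.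
by rewrite mderiv_qform scalerAr.
Qed.

Lemma laplacian_linform_pow a k :
  laplacian (linform a ^+ k.+2) =
    (k.+2 * k.+1)%:R * (dot a a)%:MP * linform a ^+ k.
Proof.
rewrite /laplacian /dot raddf_sum /= mulr_sumr mulr_suml.
apply: eq_bigr => i _.
rewrite mderivXn mderiv_linform !mderivM mderivXn mderiv_linform !mderivC.
by rewrite -mpolyC_nat mderivC mpolyC_nat natrM mpolyCM; ring.
Qed.

Lemma laplacian_qform2_linform b :
  laplacian (qform n ^+ 2 * linform b) =
    4%:R * (n + 4)%:R * qform n * linform b.
Proof.
have E i : (qform n ^+ 2 * linform b)^`M(i)^`M(i) =
    8%:R * linform b * 'X_i ^+ 2 + 4%:R * qform n * linform b
    + 8%:R * qform n * (b ord0 i *: 'X_i).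
  have -> : (qform n ^+ 2 * linform b)^`M(i) =
      4%:MP * (qform n * 'X_i * linform b) + (b ord0 i)%:MP * qform n ^+ 2.
    rewrite mderivM mderivXn mderiv_linform mderiv_qform.
    by rewrite mpolyC_nat; ring.
  rewrite mderivD !mderiv_mulC mderivXn !mderivM mderiv_linform mderiv_qform.
  by rewrite mderiv_var eqxx -mul_mpolyC mpolyC_nat /=; ring.
rewrite /laplacian (eq_bigr _ (fun i _ => E i)) !big_split /= -!mulr_sumr.
rewrite sumr_const card_ord -/(qform n) -/(linform b) natrD -mulr_natl.
by ring.
Qed.

(** The constant-coefficient operator whose symbol is [a |-> dual_cubic a b].
    Contraction of cubic operators with [q ^+ 3] commutes with the orthogonal
    group, so the operator contracting to [L_b ^+ 3] is sought among the
    combinations of [(b.d)^3] and [(b.b) Laplacian (b.d)].  The two contractions are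
    [48 L_b ^+ 3 + 72 (b.b) q L_b] and [24 (n + 4) (b.b) q L_b]; the
    coefficients [n + 4] and [- 3] cancel the [q L_b] terms. *)
Definition dual_cubic_der b p : {mpoly K[n]} :=
  (n + 4)%:R *: dirder b (dirder b (dirder b p))
  - (3 * dot b b) *: laplacian (dirder b p).

Lemma dual_cubic_der_is_linear b : linear (dual_cubic_der b).
Proof.
move=> c p q.
rewrite /dual_cubic_der !(linearP (dirder b)) (linearP laplacian) /= -!mul_mpolyC.
by ring.
Qed.

HB.instance Definition _ b :=
  GRing.isLinear.Build K {mpoly K[n]} {mpoly K[n]} _ (dual_cubic_der b)
    (dual_cubic_der_is_linear b).

(** Up to scaling, the inverse of the catalecticant of [q ^+ 3], as a kernel on
    pairs of vectors. *)
Definition dual_cubic a b : K :=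
  (n + 4)%:R * dot a b ^+ 3 - 3 * dot a a * dot b b * dot a b.

Lemma dual_cubic_der_linform6 a b :
  dual_cubic_der b (linform a ^+ 6) = (120%:R * dual_cubic a b) *: linform a ^+ 3.
Proof.
have D k c : dirder b (c%:MP * linform a ^+ k.+1) =
    (k.+1%:R * c * dot a b)%:MP * linform a ^+ k.
  rewrite dirderM dirderC dirderXn dirder_linform !mpolyCM mpolyC_nat.
  by ring.
have D1 : dirder b (linform a ^+ 6) = (6 * dot a b)%:MP * linform a ^+ 5.
  by have := D 5 1; rewrite mul1r mulr1.
rewrite /dual_cubic_der D1 mul_mpolyC [laplacian _]linearZ /= laplacian_linform_pow.
by rewrite -mul_mpolyC !D /dual_cubic -!mul_mpolyC; ring.
Qed.

Lemma dual_cubic_der_qform3 b :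
  dual_cubic_der b (qform n ^+ 3) = (48%:R * (n + 4)%:R) *: linform b ^+ 3.
Proof.
have D1 : dirder b (qform n ^+ 3) = 6 *: (qform n ^+ 2 * linform b).
  rewrite dirderXn dirder_qform -mul_mpolyC mpolyC_nat; ring.
have D2 : dirder b (qform n ^+ 2 * linform b) =
    4 *: (qform n * linform b ^+ 2) + dot b b *: qform n ^+ 2.
  rewrite dirderM dirderXn dirder_qform dirder_linform -!mul_mpolyC mpolyC_nat.
  ring.
have D3 : dirder b (qform n * linform b ^+ 2) =
    2 *: linform b ^+ 3 + (2 * dot b b) *: (qform n * linform b).
  rewrite dirderM dirderXn dirder_qform dirder_linform -!mul_mpolyC.
  by rewrite mpolyCM mpolyC_nat; ring.
have D4 : dirder b (qform n ^+ 2) = 4 *: (qform n * linform b).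
  by rewrite dirderXn dirder_qform -!mul_mpolyC mpolyC_nat; ring.
rewrite /dual_cubic_der D1 [laplacian _]linearZ /= laplacian_qform2_linform.
rewrite !linearZ /= D2 linearP /= [dirder b (_ *: qform n ^+ 2)]linearZ /= D3 D4.
rewrite -!mul_mpolyC !mpolyCM !mpolyC_nat; ring.
Qed.

End Differentiation.

(** * Cubic forms and cubes of linear forms *)

Lemma enum_monomials (n d : nat) :
  exists M : 'I_('C(d + n, d)) -> 'X_{1..n.+1},
    injective M /\ forall i, mdeg (M i) = d.
Proof.
set s := [seq s2m t | t : d.-tuple 'I_n.+1 <- enum (basis n.+1 d)].
have sz_s : size s = 'C(d + n, d) by exact: size_basis.
exists (fun i => nth 0%MM s i); split=> [i j /eqP|i].
  by rewrite nth_uniq ?uniq_basis ?sz_s // => /eqP/val_inj.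
by apply/eqP; rewrite basis_cover -/s mem_nth ?sz_s.
Qed.

(** As many polynomials as there are monomials of degree [d] are linearly
    independent as soon as they span those monomials: their coefficient matrix
    [C] on these monomials is square with a left inverse, hence invertible. *)
Lemma spanning_free (K : fieldType) (n d N : nat) (p : 'I_N -> {mpoly K[n.+1]}) :
    N = 'C(d + n, d) ->
    (forall m, mdeg m = d -> exists r : 'I_N -> K, 'X_[m] = \sum_j r j *: p j) ->
  forall r : 'I_N -> K, \sum_j r j *: p j = 0 -> forall j, r j = 0.
Proof.
move=> N_E; rewrite {N}N_E in p * => p_span r r0 j.
have [M [M_inj M_deg]] := enum_monomials n d.
have /fin_all_exists[D D_E] : forall i, exists f : 'I__ -> K,
    'X_[M i] = \sum_j f j *: p j.
  by move=> i; apply: p_span.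
pose C := \matrix_(j, k) (p j)@_(M k).
have /mulmx1C CD : (\matrix_(i, j) D i j) *m C = 1%:M.
  apply/matrixP=> i k; rewrite !mxE -(inj_eq M_inj) -mcoeffX D_E raddf_sum /=.
  by apply: eq_bigr => l _; rewrite !mxE mcoeffZ.
have rC : (\row_j r j) *m C = 0.
  apply/rowP=> k; rewrite !mxE -[RHS](mcoeff0 _ (M k)) -r0 raddf_sum /=.
  by apply: eq_bigr => l _; rewrite !mxE mcoeffZ.
have : (\row_j r j) *m C *m (\matrix_(i, j) D i j) = 0 by rewrite rC mul0mx.
by rewrite -mulmxA CD mulmx1 => /rowP/(_ j); rewrite !mxE.
Qed.

Lemma mdegS (n d : nat) (m : 'X_{1..n}) :
  mdeg m = d.+1 -> exists i m', m = (U_(i) + m')%MM /\ mdeg m' = d.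
Proof.
move=> m_deg; have [i m_i] : exists i, m i != 0%N.
  apply/existsP; rewrite -negb_forall; apply/negP => /forallP m0.
  by move: m_deg; rewrite mdegE big1 // => i _; apply/eqP.
have mE : m = (U_(i) + (m - U_(i)))%MM.
  rewrite addmC submK //; apply/mnm_lepP => j.
  by rewrite mnm1E; case: eqP => // <-; rewrite lt0n.
exists i, (m - U_(i))%MM; split=> //.
by move: m_deg; rewrite {1}mE mdegD mdeg1 => -[].
Qed.

Lemma cubic_monomial (K : fieldType) (n : nat) (m : 'X_{1..n}) :
  mdeg m = 3 -> exists a b c : 'rV[K]_n,
    'X_[m] = linform a * linform b * linform c.
Proof.
case/mdegS => i [_ [-> /mdegS[j [_ [-> /mdegS[k [m' [-> /eqP]]]]]]]].
rewrite mdeg_eq0 => /eqP->.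
exists (delta_mx ord0 i), (delta_mx ord0 j), (delta_mx ord0 k).
by rewrite !linform_delta addm0 !mpolyXD mulrA.
Qed.

Lemma polarization (K : numFieldType) (n : nat) (a b c : 'rV[K]_n) :
  linform a * linform b * linform c =
    24^-1 *: (linform (a + b + c) ^+ 3 + linform (a - b - c) ^+ 3
              - linform (a + b - c) ^+ 3 - linform (a - b + c) ^+ 3).
Proof.
have E : (24^-1)%:MP * 24 = 1 :> {mpoly K[n]}.
  by rewrite -mpolyC_nat -mpolyCM mulVf ?pnatr_eq0.
rewrite -[LHS]mul1r -E -mul_mpolyC -[LHS]mulrA; congr (_ * _).
by rewrite !linformD !linformN; ring.
Qed.

Lemma Bcoef3_scale (K : numFieldType) (n : nat) :
  1 / Bcoef3 n * (48%:R * (n + 4)%:R) = 120%:R * n.+1%:R :> K.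
Proof.
have : (n + 4)%:R != 0 :> K by rewrite pnatr_eq0 addnS.
have : n.+1%:R != 0 :> K by rewrite pnatr_eq0.
rewrite /Bcoef3 addn1 !natrM.
move: (n + 4)%:R n.+1%:R => x y y0 x0.
by field; rewrite x0 y0.
Qed.

(** * Rigidity of tight decompositions *)

Section TightDecomposition.
Variables (K : numFieldType) (n : nat).
Variable a : 'I_(tight_size3 n.+1) -> 'rV[K]_n.+1.
Hypothesis a_tight : (1 / Bcoef3 n.+1) *: qform n.+1 ^+ 3
  = \sum_(j < tight_size3 n.+1) linform (a j) ^+ 6.

(** The two sides of the decomposition become multiples of [L_b ^+ 3] and of
    the [L_(a j) ^+ 3] under [dual_cubic_der b]. *)
Lemma cube_reproducing (b : 'rV[K]_n.+1) :
  linform b ^+ 3 =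
    \sum_j (dual_cubic (a j) b / (n.+2)%:R) *: linform (a j) ^+ 3.
Proof.
have /(congr1 (dual_cubic_der b)) := a_tight.
rewrite linearZ linear_sum /= dual_cubic_der_qform3 scalerA.
rewrite (eq_bigr _ (fun j _ => dual_cubic_der_linform6 (a j) b)).
rewrite Bcoef3_scale => E.
have nz : n.+2%:R != 0 :> K by rewrite pnatr_eq0.
apply: (scalerI (_ : 120 * n.+2%:R != 0)); first by rewrite mulf_neq0 ?pnatr_eq0.
rewrite E scaler_sumr; apply: eq_bigr => j _; rewrite scalerA.
by congr (_ *: _); move: (_%:R) nz => x nz; field.
Qed.

Lemma cubes_span (m : 'X_{1..n.+1}) : mdeg m = 3 ->
  exists r : 'I_(tight_size3 n.+1) -> K,
    'X_[m] = \sum_j r j *: linform (a j) ^+ 3.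
Proof.
case/(@cubic_monomial K) => b [c [d ->]]; rewrite polarization.
rewrite !cube_reproducing -!sumrN -!big_split /= scaler_sumr.
pose t e j := dual_cubic (a j) e / n.+2%:R.
exists (fun j => 24^-1 * (t (b + c + d) j + t (b - c - d) j
                          - t (b + c - d) j - t (b - c + d) j)).
apply: eq_bigr => j _; rewrite -[RHS]scalerA; congr (_ *: _).
by rewrite !(scalerBl, scalerDl, scaleNr).
Qed.

(** With [b = a k], [cube_reproducing] is a linear relation between the cubes
    [L_(a j) ^+ 3]; their independence forces it to be the trivial one. *)
Lemma dual_cubic_tight j k :
  dual_cubic (a j) (a k) = if j == k then n.+2%:R else 0.
Proof.
have T : tight_size3 n.+1 = 'C(3 + n, 3) by rewrite /tight_size3 addSnnS addnC.
pose r l : K := dual_cubic (a l) (a k) / n.+2%:R - (l == k)%:R.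
have r0 : \sum_l r l *: linform (a l) ^+ 3 = 0.
  rewrite /r (eq_bigr _ (fun l _ => scalerBl _ _ _)) sumrB -cube_reproducing.
  rewrite (bigD1 k) //= eqxx scale1r big1 ?addr0 ?subrr // => l ne_lk.
  by rewrite (negbTE ne_lk) scale0r.
have := spanning_free T cubes_span r0 j; rewrite /r => /eqP.
rewrite subr_eq0 => /eqP E; rewrite -[dual_cubic _ _](mulfVK (_ : n.+2%:R != 0)).
  by rewrite E; case: eqP; rewrite ?mul1r ?mul0r.
by rewrite pnatr_eq0.
Qed.

End TightDecomposition.

(** * Integrality of eigenvalues *)

(** The rational root theorem for an eigenvalue [q / p] of an integer matrix,
    without its characteristic polynomial: [p B - q] is singular, and its
    determinant is [(- q) ^+ N] modulo [p]. *)
Lemma int_eigenvalue_dvd (K : numFieldType) (N p q : nat)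
    (B : 'M[int]_N) (u : 'rV[K]_N) :
    prime p -> u != 0 ->
    p%:R *: (u *m map_mx intr B) = q%:R *: u ->
  (p %| q)%N.
Proof.
move=> p_prime u_neq0 uB; pose C := p%:Z *: B - (q%:Z)%:M.
have uC : u *m map_mx intr C = 0.
  rewrite map_mxB map_mxZ map_scalar_mx /= -!pmulrn mulmxBr -scalemxAr uB.
  by rewrite mul_mx_scalar subrr.
have /eqP detC : \det C == 0.
  rewrite -(intr_eq0 K) -det_map_mx.
  by apply/det0P; exists u.
have : \det (map_mx intr C : 'M['F_p]_N) = 0 by rewrite det_map_mx detC.
rewrite map_mxB map_mxZ map_scalar_mx /= -!pmulrn.
rewrite (pcharf0 (pchar_Fp p_prime)) scale0r sub0r -scalemx1 -scaleNr detZ det1.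
move/eqP; rewrite mulr1 expf_eq0 oppr_eq0 => /andP[_].
by rewrite -(dvdn_pcharf (pchar_Fp p_prime)).
Qed.

Lemma linear_dependence (K : fieldType) (n N : nat) (V : 'M[K]_(N, n)) :
  (n < N)%N -> exists2 v : 'rV[K]_N, v != 0 & v *m V = 0.
Proof.
move=> lt_nN; have : kermx V != 0.
  rewrite -mxrank_eq0 mxrank_ker subn_eq0 -ltnNge.
  exact: leq_ltn_trans (rank_leq_col V) lt_nN.
by case/rowV0Pn => v /sub_kermxP vV v_neq0; exists v.
Qed.

(** The angle condition says that the lines spanned by the [a j] meet at angles
    of squared cosine [0] or [p / m]; the normalized Gram matrix is then an
    integer matrix up to an affine change, and it is singular because there are
    more vectors than dimensions. *)
Lemma equiangular_dvd (K : numClosedFieldType) (n N p m : nat)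
    (a : 'I_N -> 'rV[K]_n) :
    prime p -> (0 < m)%N -> (n < N)%N ->
    (forall j, dot (a j) (a j) != 0) ->
    (forall j k, j != k -> m%:R * dot (a j) (a k) ^+ 3 =
       p%:R * dot (a j) (a j) * dot (a k) (a k) * dot (a j) (a k)) ->
  (p %| m)%N.
Proof.
move=> p_prime m_gt0 lt_nN a_aniso a_angle.
have p_neq0 : p%:R != 0 :> K by rewrite pnatr_eq0 -lt0n prime_gt0.
have m_neq0 : m%:R != 0 :> K by rewrite pnatr_eq0 -lt0n.
pose s j := sqrtC (dot (a j) (a j)).
have s2 j : s j ^+ 2 = dot (a j) (a j) by rewrite sqrtCK.
have s_neq0 j : s j != 0 by rewrite sqrtC_eq0.
pose c : K := sqrtC (p%:R / m%:R).
have c2 : c ^+ 2 = p%:R / m%:R by rewrite sqrtCK.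
have c_neq0 : c != 0 by rewrite sqrtC_eq0 mulf_neq0 ?invr_eq0.
(* The normalized Gram matrix is 1 + c A: [gramE] below. *)
pose A : 'M[int]_N := \matrix_(j, k)
  if (j == k) || (dot (a j) (a k) == 0) then 0
  else if dot (a j) (a k) == c * s j * s k then 1 else -1.
have gramE j k :
    dot (a j) (a k) = s j * ((j == k)%:R + c * (A j k)%:~R) * s k.
  rewrite mxE; have [<-|ne_jk] /= := eqVneq j k.
    by rewrite mulr0 addr0 mulr1 -expr2 s2.
  have [->|d_neq0] /= := eqVneq (dot (a j) (a k)) 0.
    by rewrite mulr0 addr0 mulr0 mul0r.
  have : dot (a j) (a k) ^+ 2 = (c * s j * s k) ^+ 2.
    apply: (mulfI m_neq0); apply: (mulIf d_neq0).
    transitivity (m%:R * dot (a j) (a k) ^+ 3); first by ring.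
    by rewrite a_angle // !exprMn c2 !s2; field.
  have [-> _|/negbTE ne /eqP] := eqVneq (dot (a j) (a k)) (c * s j * s k).
    by rewrite add0r; ring.
  by rewrite eqf_sqr ne => /eqP->; rewrite add0r; ring.
have [v v_neq0 vV] := linear_dependence (\matrix_j a j) lt_nN.
pose u := \row_j (v ord0 j * s j).
have u_neq0 : u != 0.
  apply: contra_neq v_neq0 => /rowP u0; apply/rowP => j; apply/eqP.
  by have /eqP := u0 j; rewrite !mxE mulf_eq0 (negbTE (s_neq0 j)) orbF.
(* A dependency [v] between the vectors is a kernel vector of their Gram
   matrix; [u] is the matching kernel vector of [1 + c A]. *)
have v_gram k : \sum_j v ord0 j * dot (a j) (a k) = 0.
  transitivity ((v *m (\matrix_j a j) *m (a k)^T) ord0 ord0).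
    rewrite -mulmxA mxE; apply: eq_bigr => j _; congr (_ * _).
    by rewrite mxE; apply: eq_bigr => i _; rewrite !mxE.
  by rewrite vV mul0mx mxE.
have uA : u + c *: (u *m map_mx intr A) = 0.
  apply/rowP => k; apply: (mulIf (s_neq0 k)).
  rewrite [in RHS]mxE mul0r -[RHS](v_gram k).
  have -> : (u + c *: (u *m map_mx intr A)) ord0 k =
      u ord0 k + c * \sum_j u ord0 j * (A j k)%:~R.
    rewrite mxE [X in _ + X]mxE [X in c * X]mxE; congr (_ + _ * _).
    by apply: eq_bigr => j _; congr (_ * _); rewrite mxE.
  have -> : u ord0 k = \sum_j u ord0 j * (j == k)%:R.
    rewrite (bigD1 k) //= eqxx mulr1 big1 ?addr0 // => j /negbTE->.
    by rewrite mulr0.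
  rewrite mulr_sumr -big_split mulr_suml; apply: eq_bigr => j _ /=.
  by rewrite gramE [u ord0 j]mxE; ring.
have {}uA : c *: (u *m map_mx intr A) = - u.
  by apply/eqP; rewrite -addr_eq0 addrC uA.
(* The eigenvalue [- 1 / c] of [A] may be irrational; its square is [m / p]. *)
apply: (@int_eigenvalue_dvd K N p m (A *m A) u) => //.
rewrite map_mxM mulmxA.
have -> : p%:R = m%:R * c ^+ 2 by rewrite c2 mulrC divfK.
by rewrite expr2 -!scalerA scalemxAl uA mulNmx scalerN uA opprK.
Qed.

(** * The congruence *)

Lemma dim_lt_tight_size3 (n : nat) : (n.+2 < tight_size3 n.+2)%N.
Proof.
rewrite /tight_size3 addn2 binS [X in (_ + X)%N]binS bin1.
by have := bin_gt0 n.+3 3; have := bin_gt0 n.+2 2; lia.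
Qed.

Theorem theorem4p36 (R : realType) (n : nat) (hn : (1 <= n)%N) (hn1 : n <> 1%N)
    (a : 'I_(tight_size3 n) -> 'rV[R[i]]_n)
    (ha : (1 / Bcoef3 n) *: qform n ^+ 3
          = \sum_(j < tight_size3 n) linform (a j) ^+ 6) :
  (n = 2 %[mod 3])%N.
Proof.
case: n hn hn1 a ha => [|[|n]] // _ _ a ha.
have dualE := dual_cubic_tight ha.
have : (3 %| n.+2 + 4)%N.
  apply: (@equiangular_dvd _ _ _ 3 (n.+2 + 4) a) => //.
  - exact: dim_lt_tight_size3.
  - move=> j; apply/eqP => aj0; have := dualE j j.
    rewrite eqxx /dual_cubic aj0 expr0n !mulr0 subr0 => /esym/eqP.
    by rewrite pnatr_eq0.
  - move=> j k ne_jk; have /eqP := dualE j k.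
    by rewrite (negbTE ne_jk) subr_eq0 => /eqP.
by lia.
Qed.
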